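(* Let $Z$ and $Y$ be real Hilbert spaces, let $X\subset Z$ be a Borel set, and let $v\colon X\to Y$ be a map satisfying property (E) (see context). Assume either that $Y$ is infinite-dimensional or that $\dim\operatorname{Aff}X+1\leq\dim Y$. Suppose that, for some $C\geq 0$, $\mu\in\mathcal P_2(Z)$ satisfies $\mu(X)=1$ and $$\operatorname{Var}_\mu G\leq C\int_Z(\operatorname{lip}G)^2\,d\mu$$ for every convex Lipschitz function $G\colon Z\to\mathbb R$. Then $$\operatorname{Var}_{v_\#\mu}f\leq C\int_Y(\operatorname{lip}f)^2\,d(v_\#\mu)$$ for every convex Lipschitz function $f\colon Y\to\mathbb R$.
   Context: Property (E) for $v\colon X\to Y$: for every $A\subset X$, every $\rho\geq 0$, and every $1$-Lipschitz map $u\colon A\to Y$ satisfying $\|u(x)-v(x)\|\leq\rho$ for all $x\in A$, there is a $1$-Lipschitz map $\widetilde u\colon X\to Y$ with $\widetilde u|_A=u$ and $\|\widetilde u(x)-v(x)\|\leq\rho$ for all $x\in X$. $\operatorname{Aff}X$ is the affine hull of $X$. $\mathcal P_2(Z)$ is the set of Borel probability measures on $Z$ with finite second moment. Under the hypotheses $v$ is $1$-Lipschitz, hence Borel, and $v_\#\mu$ denotes the pushforward under $v$ of $\mu$ (which is concentrated on $X$), a Borel probability measure on $Y$. For a function $f\colon H\to\mathbb R$ on a Hilbert space $H$, the pointwise local Lipschitz constant is $$\operatorname{lip}f(y)=\limsup_{\substack{z\to y\\ z\neq y}}\frac{|f(z)-f(y)|}{\|z-y\|},$$ with the convention $\operatorname{lip}f(y)=0$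 if $y$ is an isolated point (i.e. if $H=\{0\}$). *)

(* Defs.v *)
From HB Require Import structures.
From mathcomp Require Import all_boot all_order all_algebra sesquilinear.
From mathcomp Require Import all_classical all_reals all_analysis.
Set Implicit Arguments.
Unset Strict Implicit.
Unset Printing Implicit Defensive.
Import Order.TTheory GRing.Theory Num.Theory.
Import numFieldNormedType.Exports.
Local Open Scope classical_set_scope.
Local Open Scope ring_scope.

HB.mixin Record NormedModule_isInnerProductSpace (R : realType) V
    of NormedModule R V := {
  inner : {dot V for idfun} ;
  inner_norm : forall x : V, inner x x = `|x| ^+ 2
}.

#[short(type="hilbertType")]
HB.structure Definition Hilbert (R : realType) :=
  {V of CompleteNormedModule R V & NormedModule_isInnerProductSpace R V}.

Notation borel T := (g_sigma_algebraType (@open T)).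

Section dimension.
Context {R : realType} {V : lmodType R}.

Definition affine_hull (X : set V) : set V :=
  [set y | exists n (a : 'I_n -> R) (x : 'I_n -> V),
    [/\ forall i, X (x i), \sum_i a i = 1 & y = \sum_i a i *: x i]].

Definition is_basis n (S : set V) (e : 'I_n -> V) : Prop :=
  [/\ forall i, S (e i),
      forall a : 'I_n -> R, \sum_i a i *: e i = 0 -> forall i, a i = 0 &
      forall x, S x -> exists a : 'I_n -> R, x = \sum_i a i *: e i].

Definition has_dim (S : set V) (n : nat) : Prop :=
  exists e : 'I_n -> V, is_basis S e.

(* The dimension of an affine subspace is that of its direction; [L] is meant
   to be nonempty. *)
Definition has_affine_dim (L : set V) (n : nat) : Prop :=
  has_dim [set x - y | x in L & y in L] n.

End dimension.

Definition infinite_dimensional {R : realType} (V : lmodType R) : Prop :=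
  forall n, ~ has_dim [set: V] n.

(* Partial maps [X -> Y] and [A -> Y] are represented by total functions whose
   values outside [X], resp. [A], are irrelevant. *)
Definition property_E {R : realType} {Z Y : normedModType R}
    (X : set Z) (v : Z -> Y) : Prop :=
  forall (A : set Z) (rho : R) (u : Z -> Y),
    A `<=` X -> 0 <= rho -> 1.-lipschitz_A u ->
    (forall x, A x -> `|u x - v x| <= rho) ->
    exists u' : Z -> Y,
      [/\ 1.-lipschitz_X u',
          forall x, A x -> u' x = u x &
          forall x, X x -> `|u' x - v x| <= rho].

(* At an isolated point the punctured neighbourhoods include [set0], and
   [limf_esup] would be [-oo]. *)
Definition lip {R : realType} {H : normedModType R} (f : H -> R) (y : H)
    : \bar R :=
  if `[< isolated [set: H] y >] then 0%E
  else limf_esup (fun z => (`|f z - f y| / `|z - y|)%:E) y^'.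

Definition finite_second_moment {R : realType} {Z : normedModType R}
    (mu : set (borel Z) -> \bar R) : Prop :=
  (\int[mu]_(z in [set: borel Z]) (`|z : Z| ^+ 2)%:E < +oo)%E.

Section pushforward_on.
Local Open Scope ereal_scope.
Context {d d'} {T : measurableType d} {T' : measurableType d'} {R : realType}.
Variables (mu : probability T R) (X : set T) (f : T -> T').
Hypotheses (mX : measurable X) (muX : mu X = 1) (mf : measurable_fun X f).

Definition pushforward_on of measurable X & mu X = 1 & measurable_fun X f :=
  fun B : set T' => mu (X `&` f @^-1` B).

Local Notation nu := (pushforward_on mX muX mf).

Let nu0 : nu set0 = 0.
Proof. by rewrite /pushforward_on preimage_set0 setI0 measure0. Qed.

Let nu_ge0 B : 0 <= nu B.
Proof. exact: measure_ge0. Qed.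

Let nu_sigma_additive : semi_sigma_additive nu.
Proof.
move=> F mF tF mUF; rewrite /pushforward_on preimage_bigcup setI_bigcupr.
apply: measure_semi_sigma_additive.
- by move=> n; exact: mf.
- apply/trivIsetP => /= i j _ _ ij; rewrite setIACA setIid -preimage_setI.
  by move/trivIsetP : tF => /(_ _ _ _ _ ij) ->//; rewrite preimage_set0 setI0.
- by rewrite -setI_bigcupr -preimage_bigcup; exact: mf.
Qed.

HB.instance Definition _ := isMeasure.Build _ _ _ nu nu0 nu_ge0 nu_sigma_additive.

Let nuT : nu setT = 1.
Proof. by rewrite /pushforward_on preimage_setT setIT. Qed.

HB.instance Definition _ := Measure_isProbability.Build _ _ _ nu nuT.

End pushforward_on.

Section property_E_theory.
Context {R : realType} {Z Y : normedModType R}.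
Variables (X : set Z) (v : Z -> Y).
Hypothesis Ev : property_E X v.

Lemma property_E_lipschitz : 1.-lipschitz_X v.
Proof.
move=> [x y] [/= Xx Xy].
have [] := Ev (A := [set x]) (rho := 0) (u := v).
- by move=> _ ->.
- by [].
- by move=> [a b] [/= -> ->]; rewrite !subrr !normr0 mulr0.
- by move=> _ ->; rewrite subrr normr0.
move=> u' [lu' _ u'v].
have e a : X a -> u' a = v a.
  by move=> /u'v; rewrite normr_le0 subr_eq0 => /eqP.
by have := lu' (x, y) (conj Xx Xy); rewrite /= !e.
Qed.

Lemma property_E_measurable :
  measurable_fun (X : set (borel Z)) (v : borel Z -> borel Y).
Proof.
move=> mX; apply: (@measurability _ _ (borel Z) (borel Y) X v (@open Y)) => //.
move=> _ [B oB <-].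
have cv : {within X, continuous v}.
  apply/subspace_continuousP => x Xx; apply/cvgrPdist_lt => e e0.
  rewrite near_withinE; near=> y => Xy.
  have := property_E_lipschitz (conj Xx Xy : (X `*` X) (x, y)).
  rewrite /= mul1r => /le_lt_trans; apply.
  by near: y; apply/nbhs_ballP; exists e => //= y; rewrite -ball_normE.
have /open_subspaceP[V oV VX] :=
  (continuousP (v : subspace X -> Y)).1 cv B oB.
rewrite setIC -VX; apply: measurableI => //.
exact: sub_sigma_algebra.
Unshelve. all: by end_near. Qed.

End property_E_theory.

(* Main.v *)
(* Property (E) does not force [v] to be affine: on the vertices x1, x2, x3, x4
   of a square (in cyclic order, with half-diagonals of length 1), the map
   sending x1, x3 to 0 and x2, x4 to a vector of norm at most 1 satisfies (E).
   What it does force is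
     <e, v x> <= sum_i mu_i <e, v x_i> + |x - sum_i mu_i x_i|
   for unit vectors [e] and convex weights [mu].  To see this, minimise a
   smoothed right-hand side over [mu].  At a minimiser, <e, v x_i> is an affine
   function of those x_i that carry weight, with slope [xi] and |xi| < 1.  Since
   [Y] has a dimension to spare, these x_i embed isometrically in [Y] in such a
   way that <e, .> restricts to <xi, .>, and (E) for this embedding translated
   far away in the direction [-e] bounds <e, v x>.

   So each <e, v .> has a convex |e|-Lipschitz extension to [Z].  The supremum
   of these extensions shifted by [alpha], over all affine minorants
   alpha + <e, .> of [f], is a convex Lipschitz function [G] on [Z] with
   G = f o v and lip G <= lip f o v on [X], to which the hypothesis on [mu]
   applies. *)
Require Import Defs.
From HB Require Import structures.
From mathcomp Require Import all_boot all_order all_algebra sesquilinear.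
From mathcomp Require Import all_classical all_reals all_analysis.
From mathcomp Require Import measurable_realfun ring lra.
Set Implicit Arguments.
Unset Strict Implicit.
Unset Printing Implicit Defensive.
Import Order.TTheory GRing.Theory Num.Theory.
Import numFieldNormedType.Exports.
Local Open Scope classical_set_scope.
Local Open Scope ring_scope.

(** * Inner products and orthonormal families *)

Definition ip {R : realType} {H : hilbertType R} (x y : H) : R := inner x y.

Section inner_product.
Context {R : realType} {H : hilbertType R}.
Implicit Types x y z : H.

Lemma ipC x y : ip x y = ip y x.
Proof. by rewrite /ip hermC /= expr0 mul1r. Qed.

Lemma ipDl x y z : ip (x + y) z = ip x z + ip y z.
Proof. exact: linearDl. Qed.

Lemma ipDr x y z : ip x (y + z) = ip x y + ip x z.
Proof. by rewrite !(ipC x) ipDl. Qed.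

Lemma ipZl a x y : ip (a *: x) y = a * ip x y.
Proof. exact: linearZl_LR. Qed.

Lemma ipZr a x y : ip x (a *: y) = a * ip x y.
Proof. by rewrite !(ipC x) ipZl. Qed.

Lemma ipNl x y : ip (- x) y = - ip x y.
Proof. by rewrite -scaleN1r ipZl mulN1r. Qed.

Lemma ipNr x y : ip x (- y) = - ip x y.
Proof. by rewrite !(ipC x) ipNl. Qed.

Lemma ip0l x : ip 0 x = 0.
Proof. by rewrite -(scale0r 0) ipZl mul0r. Qed.

Lemma ip0r x : ip x 0 = 0.
Proof. by rewrite ipC ip0l. Qed.

Lemma ip_suml I (r : seq I) (P : pred I) (F : I -> H) y :
  ip (\sum_(i <- r | P i) F i) y = \sum_(i <- r | P i) ip (F i) y.
Proof.
by elim/big_rec2 : _ => [|i a b _ <-]; rewrite ?ip0l ?ipDl.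
Qed.

Lemma ip_sumr I (r : seq I) (P : pred I) (F : I -> H) y :
  ip y (\sum_(i <- r | P i) F i) = \sum_(i <- r | P i) ip y (F i).
Proof. by rewrite ipC ip_suml; apply: eq_bigr => i _; rewrite ipC. Qed.

Lemma ipxx x : ip x x = `|x| ^+ 2.
Proof. exact: inner_norm. Qed.

Definition ipE := (ipDl, ipDr, ipNl, ipNr, ipZl, ipZr, ip0l, ip0r).

Lemma sqr_normD x y : `|x + y| ^+ 2 = `|x| ^+ 2 + 2 * ip x y + `|y| ^+ 2.
Proof. by rewrite -!ipxx !ipE (ipC y x); ring. Qed.

Lemma sqr_normB x y : `|x - y| ^+ 2 = `|x| ^+ 2 - 2 * ip x y + `|y| ^+ 2.
Proof. by rewrite -!ipxx !ipE (ipC y x); ring. Qed.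

Lemma ip_le_norm x y : ip x y <= `|x| * `|y|.
Proof.
have [->|x0] := eqVneq x 0; first by rewrite ip0l normr0 mul0r.
have [->|y0] := eqVneq y 0; first by rewrite ip0r normr0 mulr0.
have nx : 0 < `|x| by rewrite normr_gt0.
have ny : 0 < `|y| by rewrite normr_gt0.
have := sqr_ge0 `| `|y| *: x - `|x| *: y |.
rewrite sqr_normB !normrZ !normr_id ipZl ipZr.
rewrite (_ : _ + _ = 2 * (`|x| * `|y|) * (`|x| * `|y| - ip x y)); last by ring.
by rewrite pmulr_rge0 ?subr_ge0// !mulr_gt0.
Qed.

End inner_product.

Section orthonormal.
Context {R : realType} {H : hilbertType R}.

Definition orthonormal n (e : 'I_n -> H) :=
  forall i j, ip (e i) (e j) = (i == j)%:R.

Definition fcons n T (u : T) (e : 'I_n -> T) (i : 'I_n.+1) : T :=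
  oapp e u (unlift ord0 i).

Lemma fcons0 n T (u : T) (e : 'I_n -> T) : fcons u e ord0 = u.
Proof. by rewrite /fcons unlift_none. Qed.

Lemma fcons_lift n T (u : T) (e : 'I_n -> T) i :
  fcons u e (lift ord0 i) = e i.
Proof. by rewrite /fcons liftK. Qed.

Lemma orthonormal_fcons n (u : H) (e : 'I_n -> H) :
  `|u| = 1 -> (forall i, ip u (e i) = 0) -> orthonormal e ->
  orthonormal (fcons u e).
Proof.
move=> u1 ue oe i j.
case: (unliftP ord0 i) => [i'|] ->; case: (unliftP ord0 j) => [j'|] ->;
  rewrite ?fcons0 ?fcons_lift.
- by rewrite oe (inj_eq lift_inj).
- by rewrite ipC ue eq_sym (negbTE (neq_lift _ _)).
- by rewrite ue (negbTE (neq_lift _ _)).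
- by rewrite ipxx u1 expr1n eqxx.
Qed.

Lemma ip_orthonormal n (e : 'I_n -> H) (a : 'I_n -> R) i :
  orthonormal e -> ip (\sum_j a j *: e j) (e i) = a i.
Proof.
move=> oe; rewrite ip_suml (bigD1 i)//= big1 ?addr0.
  by rewrite ipZl oe eqxx mulr1.
by move=> j ji; rewrite ipZl oe (negbTE ji) mulr0.
Qed.

Lemma ip_orthonormal_sum n (e : 'I_n -> H) (a b : 'I_n -> R) :
  orthonormal e ->
  ip (\sum_j a j *: e j) (\sum_j b j *: e j) = \sum_j a j * b j.
Proof.
move=> oe; rewrite ip_sumr; apply: eq_bigr => i _.
by rewrite ipZr ip_orthonormal// mulrC.
Qed.

Definition proj n (e : 'I_n -> H) (y : H) := \sum_i ip y (e i) *: e i.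

Lemma proj_linear n (e : 'I_n -> H) a x y :
  proj e (a *: x + y) = a *: proj e x + proj e y.
Proof.
rewrite /proj scaler_sumr -big_split; apply: eq_bigr => i _ /=.
by rewrite !ipE scalerDl scalerA.
Qed.

Lemma orthonormal_extend n (e : 'I_n -> H) (y : H) :
  orthonormal e -> proj e y != y ->
  exists2 u, `|u| = 1 /\ (forall i, ip u (e i) = 0) &
    exists2 a, a != 0 & u = a *: (y - proj e y).
Proof.
move=> oe; rewrite eq_sym -subr_eq0 -normr_gt0 => r0.
exists (`|y - proj e y|^-1 *: (y - proj e y)); last first.
  by exists `|y - proj e y|^-1 => //; rewrite invr_eq0 gt_eqF.
split=> [|i]; first by rewrite normrZ normfV normr_id mulVf// gt_eqF.
by rewrite ipZl ipDl ipNl ip_orthonormal// subrr mulr0.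
Qed.

Definition submodule (P : set H) :=
  P 0 /\ forall a x y, P x -> P y -> P (a *: x + y).

Lemma submodule_sum (P : set H) n (a : 'I_n -> R) (x : 'I_n -> H) :
  submodule P -> (forall i, P (x i)) -> P (\sum_i a i *: x i).
Proof.
by move=> [P0 PD] Px; elim/big_rec : _ => // i y _ Py; exact: PD.
Qed.

Lemma submoduleZ (P : set H) a x : submodule P -> P x -> P (a *: x).
Proof. by move=> [P0 PD] Px; rewrite -[_ *: _]addr0; exact: PD. Qed.

Lemma submoduleB (P : set H) x y : submodule P -> P x -> P y -> P (x - y).
Proof. by move=> [P0 PD] Px Py; rewrite addrC -scaleN1r; exact: PD. Qed.

(** Span membership is expressed as being fixed by [proj o]. The [d i] may be dependent: induction
    on [n] adds the normalised residual of [d ord0] only when it is nonzero, and that residual stays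
    in the submodule [P]. *)
Lemma gram_schmidt (P : set H) n (d : 'I_n -> H) :
  submodule P -> (forall i, P (d i)) ->
  exists k (o : 'I_k -> H), [/\ orthonormal o, forall i, P (o i) &
    forall i, proj o (d i) = d i].
Proof.
move=> sP; elim: n d => [|n IH] d Pd.
  by exists 0%N, (fun=> 0); split; [case|case|case].
have [k [ o [oo Po od]]] := IH (fun i => d (lift ord0 i)) (fun i => Pd _).
have [e0|e0] := eqVneq (proj o (d ord0)) (d ord0).
  exists k, o; split=> // i.
  by case: (unliftP ord0 i) => [j|] ->.
have [u [u1 uo] [a a0 uE]] := orthonormal_extend oo e0.
have pE y : proj (fcons u o) y = ip y u *: u + proj o y.
  rewrite /proj big_ord_recl fcons0; congr (_ + _).
  by apply: eq_bigr => i _; rewrite fcons_lift.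
exists k.+1, (fcons u o); split.
- exact: orthonormal_fcons.
- move=> i; case: (unliftP ord0 i) => [j|] ->; rewrite ?fcons_lift ?fcons0//.
  rewrite uE; apply: submoduleZ => //; apply: submoduleB => //.
  exact: submodule_sum.
- move=> i; case: (unliftP ord0 i) => [j|] ->; rewrite pE.
    rewrite -{1}[d _]od ip_suml big1 ?scale0r ?add0r// => l _.
    by rewrite ipZl (ipC (o l)) uo mulr0.
  have dE : d ord0 = a^-1 *: u + proj o (d ord0).
    by rewrite uE scalerA mulVf// scale1r subrK.
  rewrite {1}dE ipDl ipZl ipxx u1 expr1n mulr1 ip_suml big1 ?addr0 -?dE//.
  by move=> l _; rewrite ipZl (ipC (o l)) uo mulr0.
Qed.

End orthonormal.

(** * Dimension counts and spare orthonormal directions *)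

Section dimension_lemmas.
Context {R : realType} {H : hilbertType R}.

(** The coefficient matrix has more rows than columns, so a nonzero row vector annihilates it from
    the left. *)
Lemma linear_dependence n k (a : 'I_n -> H) (b : 'I_k -> H)
    (c : 'I_n -> 'I_k -> R) : (k < n)%N ->
  (forall i, a i = \sum_j c i j *: b j) ->
  exists2 u : 'I_n -> R, \sum_i u i *: a i = 0 & exists i, u i != 0.
Proof.
move=> kn aE; pose M : 'M[R]_(n, k) := \matrix_(i, j) c i j.
have : kermx M != 0.
  rewrite kermx_eq0 /row_free neq_ltn (leq_ltn_trans _ kn)//.
  exact: rank_leq_col.
case/rowV0Pn => r /sub_kermxP rM r0.
exists (fun i => r 0 i); last by move: r0 => /rV0Pn.
under eq_bigr do rewrite aE scaler_sumr.
rewrite exchange_big big1//= => j _.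
under eq_bigr do rewrite scalerA.
rewrite -scaler_suml (_ : \sum_i _ = 0) ?scale0r//.
move/rowP : rM => /(_ j); rewrite !mxE => rMj.
by rewrite -[RHS]rMj; apply: eq_bigr => i _; rewrite mxE.
Qed.

Lemma orthonormal_free n (e : 'I_n -> H) (a : 'I_n -> R) :
  orthonormal e -> \sum_i a i *: e i = 0 -> forall i, a i = 0.
Proof. by move=> oe e0 i; rewrite -(ip_orthonormal a i oe) e0 ip0l. Qed.

(** Allowing every [j <= k] makes the property pass to smaller [k], so that orthonormal families can
    be grown one vector at a time. *)
Definition extendable k := forall j (e : 'I_j -> H), (j <= k)%N ->
  orthonormal e -> exists2 u, `|u| = 1 & forall i, ip u (e i) = 0.

(** At each stage the family to be extended includes [e0]; the last stage extends [k] vectors,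
    namely [e0] and the [k - 1] found before. *)
Lemma extendable_orthonormal (e0 : H) k : `|e0| = 1 -> extendable k ->
  exists2 e : 'I_k -> H, orthonormal e & forall i, ip e0 (e i) = 0.
Proof.
move=> e01; elim: k => [|k IH] ek; first by exists (fun=> 0); case.
have [j e jk|e oe ee] := IH.
  by apply: ek; rewrite (leq_trans jk).
have [u u1 ue] := ek _ _ (leqnn _) (orthonormal_fcons e01 ee oe).
exists (fcons u e).
  by apply: orthonormal_fcons => // i; rewrite -(ue (lift ord0 i)) fcons_lift.
move=> i; case: (unliftP ord0 i) => [j|] ->; rewrite ?fcons_lift ?fcons0//.
by rewrite ipC -(ue ord0) fcons0.
Qed.

Lemma extendableP k : (forall j, (j <= k)%N -> forall e : 'I_j -> H,
    orthonormal e -> exists y, proj e y != y) ->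
  extendable k.
Proof.
move=> H1 j e jk oe; have [y yP] := H1 _ jk _ oe.
by have [u [u1 ue] _] := orthonormal_extend oe yP; exists u.
Qed.

Lemma infinite_dimensional_extendable k :
  infinite_dimensional H -> extendable k.
Proof.
move=> infH; apply: extendableP => j _ e oe.
apply: contrapT => /forallNP pE; apply: (infH j); exists e.
split=> // [a|x _]; first exact: orthonormal_free.
exists (fun i => ip x (e i)); by move/negP/negPn/eqP : (pE x).
Qed.

(** If an orthonormal family of [j < n] vectors had no unit vector orthogonal to it, it would span
    the space, and the [n] basis vectors would be dependent. *)
Lemma has_dim_extendable n k :
  has_dim [set: H] n -> (k < n)%N -> extendable k.
Proof.
move=> [b [_ bfree _]] kn; apply: extendableP => j jk e oe.
apply: contrapT => /forallNP pE.
have [||u u0 [i ui]] := @linear_dependence n j b e (fun i l => ip (b i) (e l)).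
- exact: leq_ltn_trans kn.
- by move=> i; move/negP/negPn/eqP : (pE (b i)).
- by move: ui; rewrite (bfree _ u0) eqxx.
Qed.

Lemma orthonormal_card n m (b : 'I_m -> H) (e : 'I_n -> H) :
  orthonormal e -> (forall i, exists a, e i = \sum_j a j *: b j) ->
  (n <= m)%N.
Proof.
move=> oe /choice[c eE]; rewrite leqNgt; apply/negP => mn.
have [u u0 [i]] := linear_dependence mn eE.
by rewrite (orthonormal_free oe u0) eqxx.
Qed.

Lemma submodule_span m (b : 'I_m -> H) :
  submodule [set z | exists a, z = \sum_j a j *: b j].
Proof.
split=> [|c _ _ [a1 ->] [a2 ->]].
  by exists (fun=> 0); rewrite big1// => i _; rewrite scale0r.
exists (fun j => c * a1 j + a2 j); rewrite scaler_sumr -big_split.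
by apply: eq_bigr => i _; rewrite /= scalerDl scalerA.
Qed.

End dimension_lemmas.

Arguments extendable {R} H k.

(** * Isometric copies in [Y] with one coordinate prescribed *)

Section room.
Context {R : realType} {Z Y : hilbertType R}.

(* [Y] can hold the copy of any orthonormal family of [P] and one further
   dimension. *)
Definition room (P : set Z) := forall k (e : 'I_k -> Z),
  orthonormal e -> (forall i, P (e i)) -> extendable Y k.

(** For infinite-dimensional [Y] the whole of [Z] serves as [P]. Otherwise [P] is the span of a
    basis of the direction of the affine hull, so its orthonormal families have at most [m < n]
    members. *)
Lemma dim_room (X : set Z) :
  infinite_dimensional Y \/
  (exists m n, [/\ has_affine_dim (affine_hull X) m,
                   has_dim [set: Y] n & (m + 1 <= n)%N]) ->
  exists P : set Z,
    [/\ submodule P, forall x y, X x -> X y -> P (x - y) & room P].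
Proof.
case=> [infY|[m [n [[b [_ _ bspan]] dimY mn]]]].
  exists setT; split=> // k e _ _; exact: infinite_dimensional_extendable.
exists [set z | exists a, z = \sum_j a j *: b j]; split.
- exact: submodule_span.
- have XA x : X x -> affine_hull X x.
    move=> Xx; exists 1%N, (fun=> 1), (fun=> x).
    by split => //; rewrite big_ord1// scale1r.
  move=> x y Xx Xy; apply: bspan; exists x; first exact: XA.
  by exists y => //; exact: XA.
- move=> k e oe eP; apply: has_dim_extendable dimY _.
  by rewrite -addn1 (leq_trans _ mn)// leq_add2r (orthonormal_card oe eP).
Qed.

(** [D] is the span of [xi] and the [d i], and [B] copies it isometrically into the orthogonal
    complement of [e]. Adding the component [ip xi w] along [e] lengthens vectors; subtracting a
    multiple of [xi] before applying [B] compensates exactly. *)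
Lemma isometry_prescribed (P : set Z) n (d : 'I_n -> Z) (xi : Z) (e : Y) :
  submodule P -> room P -> (forall i, P (d i)) -> P xi -> `|xi| < 1 ->
  `|e| = 1 ->
  exists (U : {linear Z -> Y}) (D : set Z),
    [/\ submodule D, forall i, D (d i) &
        forall w, D w -> `|U w| = `|w| /\ ip e (U w) = ip xi w].
Proof.
move=> sP rP Pd Pxi xi1 e1.
have [i|k [ o' [oo Po od]]] := @gram_schmidt _ _ P _ (fcons xi d) sP.
  by case: (unliftP ord0 i) => [j|] ->; rewrite ?fcons_lift ?fcons0.
have pxi : proj o' xi = xi by rewrite -(fcons0 xi d) od.
have [f of_ ef] := extendable_orthonormal e1 (rP _ _ oo Po).
pose B w := \sum_j ip w (o' j) *: f j.
have BB w : proj o' w = w -> ip (B w) (B w) = ip w w.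
  by move=> pw; rewrite -{3 4}pw !ip_orthonormal_sum.
have eB w : ip e (B w) = 0.
  by rewrite ip_sumr big1// => j _; rewrite ipZr ef mulr0.
have Blin a x y : B (a *: x + y) = a *: B x + B y.
  rewrite /B scaler_sumr -big_split; apply: eq_bigr => j _ /=.
  by rewrite !ipE scalerDl scalerA.
(* The root [(1 - s) / |xi|^2] of the quadratic equation for [kp] is written below as [(1 + s)^-1],
   which also makes sense for [xi = 0]. *)
pose s := Num.sqrt (1 - `|xi| ^+ 2).
have s0 : 0 <= s by exact: sqrtr_ge0.
have sE : `|xi| ^+ 2 = 1 - s ^+ 2.
  have /sqr_sqrtr -> : 0 <= 1 - `|xi| ^+ 2 by rewrite subr_ge0 expr_le1// ltW.
  by rewrite subKr.
have s1 : 1 + s != 0 by rewrite gt_eqF// ltr_wpDr.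
(* [kp] solves [kp ^+ 2 * `|xi| ^+ 2 - 2 * kp + 1 = 0], which makes [V] an
   isometry on the span of [o']. *)
pose kp := (1 + s)^-1.
pose V w := ip xi w *: e + B (w - (kp * ip xi w) *: xi).
have Vlin : linear V.
  move=> a x y; rewrite /V !ipE.
  have -> : a *: x + y - (kp * (a * ip xi x + ip xi y)) *: xi =
     a *: (x - (kp * ip xi x) *: xi) + (y - (kp * ip xi y) *: xi).
    rewrite scalerBr addrACA -opprD scalerA -scalerDl.
    by congr (_ - _ *: _); ring.
  by rewrite Blin scalerDl scalerDr -scalerA !scalerA addrACA.
pose U : {linear Z -> Y} := HB.pack V (GRing.isLinear.Build _ _ _ _ V Vlin).
have UE w : U w = V w by [].
exists U, [set w | proj o' w = w]; split.
- split=> [|a x y /= px py]; last by rewrite proj_linear px py.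
  by rewrite /= /proj big1// => i _; rewrite ip0l scale0r.
- by move=> i; rewrite /= -(fcons_lift xi d) od.
move=> w pw; rewrite /= in pw; rewrite UE /V {U UE Vlin V}; split; last first.
  by rewrite !ipE eB ipxx e1 expr1n addr0 mulr1.
apply/eqP; rewrite -(@eqrXn2 _ 2)//; apply/eqP.
rewrite -!ipxx !ipE eB (ipC (B _) e) eB BB; last first.
  by rewrite addrC -scaleNr proj_linear pw pxi.
rewrite !ipE (ipxx e) e1 (ipC w xi) (ipxx xi) sE /kp.
by field.
Qed.

End room.

(** * Property (E) and convex combinations *)

Section convex_weights.
Context {R : realType} {Z : hilbertType R}.

Definition convex_weights n (a : 'I_n -> R) :=
  (forall i, 0 <= a i) /\ \sum_i a i = 1.

Lemma continuous_sum (T : topologicalType) (V : normedModType R) n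
    (F : 'I_n -> T -> V) :
  (forall i, continuous (F i)) -> continuous (fun x => \sum_i F i x).
Proof.
move=> cF; apply: continuous_big => //; exact: add_continuous.
Qed.

Lemma convex_weights_compact n :
  compact [set r : 'rV[R]_n | convex_weights (r 0)].
Proof.
apply: bounded_closed_compact.
  exists 1; split=> // M M1 r [/= r0 r1].
  apply: (le_trans _ (ltW M1)); rewrite [leLHS]/Num.norm/= mx_normrE.
  apply: bigmax_le => // -[i j] _ /=; rewrite ord1 ger0_norm//.
  by rewrite -r1 (bigD1 j)//= lerDl sumr_ge0.
rewrite (_ : mkset _ = (\bigcap_(i in [set: 'I_n])
    (fun r : 'rV[R]_n => r 0 i) @^-1` [set t | 0 <= t]) `&`
    (fun r : 'rV[R]_n => \sum_i r 0 i) @^-1` [set 1]); last first.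
  by apply/seteqP; split=> r [r0 r1]; split=> // i; [move=> _|]; exact: r0.
apply: closedI.
  apply: closed_bigI => i _; apply: closed_comp; last exact: closed_ge.
  by move=> r _; exact: coord_continuous.
apply: closed_comp; last exact: closed_eq.
by move=> r _; apply: continuous_sum => i; exact: coord_continuous.
Qed.

(** The right-hand side is the tangent line of the square root at [N ^+ 2]; its square exceeds
    [N ^+ 2 + t] by [(t / (2 * N)) ^+ 2]. *)
Lemma sqrtrD_le (N t : R) : 0 < N -> 0 <= N ^+ 2 + t ->
  Num.sqrt (N ^+ 2 + t) <= N + t / (2 * N).
Proof.
move=> N0 Nt.
have y0 : 0 <= N + t / (2 * N).
  have -> : N + t / (2 * N) = (N ^+ 2 + (N ^+ 2 + t)) / (2 * N).
    by field; rewrite gt_eqF.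
  by apply: divr_ge0; [rewrite addr_ge0 ?sqr_ge0|rewrite mulr_ge0 ?ltW].
rewrite -[leRHS]ger0_norm// -sqrtr_sqr ler_wsqrtr//.
have -> : (N + t / (2 * N)) ^+ 2 = N ^+ 2 + t + (t / (2 * N)) ^+ 2.
  by field; rewrite gt_eqF.
by rewrite lerDl sqr_ge0.
Qed.

(** First-order condition at an endpoint: divide by [s] and let [s] tend to 0. *)
Lemma quadratic_slope_ge0 (b K s0 : R) : 0 < s0 ->
  (forall s, 0 < s <= s0 -> 0 <= s * b + s ^+ 2 * K) -> 0 <= b.
Proof.
move=> s00 H; rewrite leNgt; apply/negP => b0.
(* This size gives [s * K <= - b / 2], hence [b + s * K < 0]; the summand 1 covers [K = 0]. *)
pose s := Num.min s0 (- b / (2 * (`|K| + 1))).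
have K1 : 0 < `|K| + 1 by rewrite ltr_wpDl.
have s_gt0 : 0 < s by rewrite lt_min s00 divr_gt0 ?oppr_gt0 ?mulr_gt0.
have /H : 0 < s <= s0 by rewrite s_gt0 ge_min lexx.
rewrite expr2 -mulrA -mulrDr pmulr_rge0// leNgt => /negP; apply.
have : s * (2 * (`|K| + 1)) <= - b.
  by rewrite -ler_pdivlMr ?mulr_gt0// ge_min lexx orbT.
have : s * K <= s * (`|K| + 1).
  by rewrite ler_pM2l// (le_trans (ler_norm _))// lerDl.
by rewrite mulrCA; lra.
Qed.

(** For [delta > 0] the root stays positive, so it is differentiable in the weights even where the
    combination vanishes. *)
Definition smooth_norm n (d : 'I_n -> Z) (delta : R) (a : 'I_n -> R) : R :=
  Num.sqrt (`|\sum_i a i *: d i| ^+ 2 + delta ^+ 2).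

(** A minimiser exists by compactness. There the partial derivatives agree at all indices of
    positive weight; the last clause is this equality solved for [g i], with [c] the common
    value. *)
Lemma convex_weights_min n (d : 'I_n -> Z) (g : 'I_n -> R) (delta : R)
    (mu : 'I_n -> R) : 0 < delta -> convex_weights mu ->
  exists lam c, [/\ convex_weights lam,
    \sum_i lam i * g i + smooth_norm d delta lam <=
      \sum_i mu i * g i + smooth_norm d delta mu &
    forall i, 0 < lam i ->
      g i = c - (smooth_norm d delta lam)^-1 *
        ip (\sum_i lam i *: d i) (d i)].
Proof.
move=> delta0 wmu; set N := smooth_norm d delta.
have N0 a : 0 < N a by rewrite sqrtr_gt0 ltr_wpDl ?sqr_ge0 ?exprn_gt0.
pose phi a := \sum_i a i * g i + N a.
have cphi : continuous (fun r : 'rV[R]_n => phi (r 0)).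
  have ccoord i : continuous (fun r : 'rV[R]_n => r 0 i).
    exact: coord_continuous.
  have c1 : continuous (fun r : 'rV[R]_n => \sum_i r 0 i * g i).
    apply: (@continuous_sum _ R^o _ (fun i (r : 'rV[R]_n) => r 0 i * g i)).
    move=> i r.
    exact: (continuousM (@ccoord i r) (@cst_continuous _ _ (g i) r)).
  have c2 : continuous (fun r : 'rV[R]_n => \sum_i r 0 i *: d i).
    apply: (@continuous_sum _ Z _ (fun i (r : 'rV[R]_n) => r 0 i *: d i)).
    move=> i r.
    exact: (continuousZr_tmp (@ccoord i r)).
  have c3 : continuous (fun r : 'rV[R]_n => N (r 0)).
    move=> r; pose f (r : 'rV[R]_n) := `|\sum_i r 0 i *: d i| ^+ 2.
    have c4 : {for r, continuous f}.
      have c5 := continuous_comp (c2 r) (@norm_continuous _ Z _).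
      exact: (continuous_comp c5 (@exprn_continuous R 2 _)).
    have c6 := continuousD c4 (@cst_continuous _ _ (delta ^+ 2) r).
    exact: (continuous_comp c6 (@sqrt_continuous R _)).
  exact: (fun r => continuousD (c1 r) (c3 r)).
have rowE (a : 'I_n -> R) : (\row_i a i) 0 = a.
  by apply/funext => i; rewrite mxE.
have [|r] := EVT_min_rV _ (@convex_weights_compact n)
    (continuous_subspaceT cphi).
  by exists (\row_i mu i); rewrite /= rowE.
rewrite inE/= => wr rmin; set lam := r 0 in wr rmin.
have {}rmin a : convex_weights a -> phi lam <= phi a.
  by move=> wa; rewrite -(rowE a); apply: rmin; rewrite inE/= rowE.
set w := \sum_i lam i *: d i.
(* [h i] is the partial derivative of [phi] at [lam] in the weight [i]. *)
pose h i := g i + (N lam)^-1 * ip w (d i).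
(* Shift a small weight [s] from [j] to [i]. By the tangent bound [sqrtrD_le], [phi] grows by at
   most [s * (h i - h j) + s ^+ 2 * K], and by minimality it does not decrease. *)
have hle i j : 0 < lam j -> h j <= h i.
  move=> lj; rewrite -subr_ge0.
  pose K := `|d i - d j| ^+ 2 / (2 * N lam).
  apply: (@quadratic_slope_ge0 _ K (lam j)) => // s /andP[s0 sj].
  rewrite {}/K.
  pose a k := lam k + s * ((k == i)%:R - (k == j)%:R).
  (* Stated for any module so as to serve the total weight, the values [g] and the vectors [d]. *)
  have sumE (V : lmodType R) (F : 'I_n -> V) : \sum_k a k *: F k =
      \sum_k lam k *: F k + s *: (F i - F j).
    rewrite /a; under eq_bigr do rewrite scalerDl -scalerA scalerBl.
    rewrite big_split/= -scaler_sumr sumrB; congr (_ + _ *: (_ - _)).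
      rewrite (bigD1 i)//= eqxx scale1r big1 ?addr0// => k /negbTE ->.
      by rewrite scale0r.
    rewrite (bigD1 j)//= eqxx scale1r big1 ?addr0// => k /negbTE ->.
    by rewrite scale0r.
  have wa : convex_weights a.
    split.
      move=> k; rewrite /a; have [->|kj] := eqVneq k j.
        by case: (_ == _); rewrite ?subrr ?mulr0 ?addr0 ?(ltW lj)// sub0r
          mulrN1 subr_ge0.
      by rewrite subr0 addr_ge0 ?mulr_ge0 ?ler0n ?(ltW s0)//; apply wr.1.
    have := sumE R^o (fun=> 1); rewrite subrr scaler0 addr0.
    under eq_bigr do rewrite [_ *: _]mulr1.
    by under [in RHS]eq_bigr do rewrite [_ *: _]mulr1; rewrite wr.2.
  have := rmin _ wa; rewrite /phi.
  have -> : \sum_k a k * g k = \sum_k lam k * g k + s * (g i - g j).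
    exact: (sumE R^o g).
  have NE : N lam ^+ 2 = `|w| ^+ 2 + delta ^+ 2.
    by rewrite sqr_sqrtr// addr_ge0 ?sqr_ge0.
  pose t := 2 * s * ip w (d i - d j) + s ^+ 2 * `|d i - d j| ^+ 2.
  have tE : `|w + s *: (d i - d j)| ^+ 2 + delta ^+ 2 = N lam ^+ 2 + t.
    rewrite NE sqr_normD ipZr normrZ exprMn real_normK ?num_real// /t.
    by ring.
  rewrite {2}/N /smooth_norm sumE -/w tE => le1.
  have /sqrtrD_le : 0 <= N lam ^+ 2 + t by rewrite -tE addr_ge0 ?sqr_ge0.
  move=> /(_ (N0 _)) le2.
  have -> : s * (h i - h j) + s ^+ 2 * (`|d i - d j| ^+ 2 / (2 * N lam)) =
      s * (g i - g j) + t / (2 * N lam).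
    rewrite /h /t !ipE; field; exact: lt0r_neq0.
  by lra.
have [i0 li0] : exists i, 0 < lam i.
  apply: contrapT => /forallNP l0; have := wr.2; rewrite big1.
    by move/eqP; rewrite eq_sym oner_eq0.
  move=> i _; apply/eqP; rewrite eq_le wr.1 andbT leNgt; exact/negP.
exists lam, (h i0); split=> //; first exact: rmin.
move=> i li; have -> : h i0 = h i by apply/eqP; rewrite eq_le !hle.
by rewrite /h addrK.
Qed.

End convex_weights.

Section property_E_inequality.
Context {R : realType} {Z Y : hilbertType R}.

Lemma property_E_weights (X : set Z) (v : Z -> Y) (P : set Z) (e : Y) (x : Z)
    n (xs : 'I_n -> Z) (mu : 'I_n -> R) :
  property_E X v -> submodule P -> (forall a b, X a -> X b -> P (a - b)) ->
  room (Y := Y) P -> X x -> (forall i, X (xs i)) -> convex_weights mu ->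
  `|e| = 1 ->
  ip e (v x) <= \sum_i mu i * ip e (v (xs i)) + `|x - \sum_i mu i *: xs i|.
Proof.
move=> Ev sP XP rP Xx Xxs wmu e1; apply/ler_addgt0Pr => delta delta0.
pose d i := xs i - x; pose g i := ip e (v (xs i)).
have dE a : convex_weights a -> \sum_i a i *: d i = \sum_i a i *: xs i - x.
  move=> [_ a1]; under eq_bigr do rewrite scalerBr.
  by rewrite sumrB -scaler_suml a1 scale1r.
have [lam [c [wlam lam_le lam_c]]] := convex_weights_min d g delta0 wmu.
set N := smooth_norm d delta in lam_le lam_c.
set w := \sum_i lam i *: d i in lam_c.
have wN : `|w| < N lam.
  rewrite -[ltLHS]ger0_norm// -sqrtr_sqr ltr_sqrt ?ltrDl ?exprn_gt0//.
  by rewrite ltr_wpDl ?sqr_ge0 ?exprn_gt0.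
have N0 : 0 < N lam by rewrite (le_lt_trans _ wN).
have Nmu : N mu <= `|x - \sum_i mu i *: xs i| + delta.
  rewrite /N /smooth_norm dE// distrC.
  rewrite -[leRHS]ger0_norm ?addr_ge0 ?(ltW delta0)//.
  rewrite -sqrtr_sqr ler_wsqrtr// sqrrD lerD2r lerDl.
  by rewrite mulrn_wge0 ?mulr_ge0 ?(ltW delta0).
(* The smoothed norm is above [|w|] at [lam] and at most [delta] above the true norm at [mu], so
   minimality carries the bound from [lam] to [mu]. *)
suff : ip e (v x) <= \sum_i lam i * g i + `|w|.
  by rewrite -/(g _); move: lam_le wN Nmu; rewrite /g; lra.
pose xi := - (N lam)^-1 *: w.
have Pd i : P (d i) by exact: XP.
have Pw : P w by exact: submodule_sum.
have xi1 : `|xi| < 1.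
  rewrite normrZ normrN normfV (gtr0_norm N0) mulrC ltr_pdivrMr//.
  by rewrite mul1r.
have [U [D [sD Dd Uiso]]] :=
  isometry_prescribed sP rP Pd (submoduleZ _ sP Pw) xi1 e1.
have gE i : 0 < lam i -> g i = c + ip xi (d i).
  by move/lam_c => ->; rewrite /xi ipZl mulNr.
have -> : \sum_i lam i * g i = c + ip xi w.
  rewrite -[c]mul1r -wlam.2 mulr_suml ip_sumr -big_split.
  apply: eq_bigr => i _ /=; rewrite ipZr -mulrDr.
  have := wlam.1 i; rewrite le_eqVlt => /predU1P[<-|/gE ->//].
  by rewrite !mul0r.
apply/ler_addgt0Pr => eta eta0.
pose p i := v (xs i) - U (d i).
pose M := \sum_i `|p i| ^+ 2.
have M0 : 0 <= M by rewrite sumr_ge0// => i _; exact: sqr_ge0.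
(* Since [ip e (p i) = c], the shift [t = T - c] gives [|p i + t *: e|^2 = |p i|^2 + T^2 - c^2 <= T
   * eta + T^2 <= (T + eta)^2]. Thus the distance from [v] exceeds [T] by at most [eta]. *)
pose T := M / eta; have T0 : 0 <= T by rewrite divr_ge0// ltW.
pose t := T - c; pose u z := U (z - x) - t *: e.
(* Only points of positive weight enter, since only there is [g i] known to be affine in [d i]. *)
pose A := [set z | exists2 i, 0 < lam i & z = xs i].
have [|||_ [i li ->]|u' [u'lip u'u u'v]] := Ev A (T + eta) u.
- by move=> _ [i _ ->].
- by rewrite addr_ge0// ltW.
- move=> [_ _] [/= [i _ ->] [j _ ->]]; rewrite /u mul1r.
  rewrite opprD addrACA subrr addr0 -linearB/= -/(d i) -/(d j).
  by rewrite (Uiso _ (submoduleB sD (Dd i) (Dd j))).1 /d opprB addrA subrK.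
- have -> : u (xs i) - v (xs i) = - (p i + t *: e).
    by rewrite /u /p -/(d i) opprD opprB addrAC.
  have ep : ip e (p i) = c.
    rewrite ipDr ipNr (Uiso _ (Dd i)).2 -/(g i) gE//.
    by rewrite addrK.
  have pM : `|p i| ^+ 2 <= M.
    by rewrite /M (bigD1 i)//= lerDl sumr_ge0// => j _; exact: sqr_ge0.
  have Te : 0 <= T + eta by rewrite addr_ge0// ltW.
  rewrite normrN -(@ler_pXn2r _ 2)// ?nnegrE// sqr_normD ipZr ipC ep.
  rewrite normrZ e1 mulr1 real_normK ?num_real// /t.
  have : M = T * eta by rewrite /T mulfVK ?gt_eqF.
  have : 0 <= T * eta by rewrite mulr_ge0// ltW.
  by have := sqr_ge0 c; have := sqr_ge0 eta; nra.
pose q := u' x + t *: e.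
(* This is [|q - U (d i)| <= |U (d i)|] squared. It is linear in [d i], so it can be averaged with
   the weights [lam], giving [|q - U w| <= |U w| = |w|]. *)
have qU i : 0 < lam i -> `|q| ^+ 2 <= 2 * ip q (U (d i)).
  move=> li; have Ai : A (xs i) by exists i.
  have := u'lip (x, xs i) (conj Xx (Xxs i)); rewrite /= mul1r (u'u _ Ai) => le1.
  have : `|q - U (d i)| ^+ 2 <= `|d i| ^+ 2.
    rewrite ler_pXn2r ?nnegrE// -[leRHS]normrN opprB.
    by rewrite (le_trans _ le1)// /u opprD opprK addrCA addrC -/(d i).
  by rewrite sqr_normB (Uiso _ (Dd i)).1; lra.
have Uw : `|U w| = `|w| /\ ip e (U w) = ip xi w.
  by apply: Uiso; exact: submodule_sum.
have qUw : `|q - U w| <= `|w|.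
  rewrite -(@ler_pXn2r _ 2)// ?nnegrE// sqr_normB Uw.1 gerDr subr_le0.
  have -> : `|q| ^+ 2 = \sum_i lam i * `|q| ^+ 2.
    by rewrite -mulr_suml wlam.2 mul1r.
  rewrite linear_sum ip_sumr mulr_sumr; apply: ler_sum => i _.
  rewrite linearZ/= ipZr [leRHS]mulrCA.
  have := wlam.1 i; rewrite le_eqVlt => /predU1P[<-|li].
    by rewrite !mul0r.
  by rewrite ler_pM2l// qU.
have eq_ : ip e (q - U w) <= `|w|.
  by rewrite (le_trans (ip_le_norm _ _))// e1 mul1r.
have evx : ip e (v x - u' x) <= T + eta.
  by rewrite (le_trans (ip_le_norm _ _))// e1 mul1r distrC u'v.
(* The large [T] cancels: passing from [v x] to [q] costs [T + eta - t = c + eta]. *)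
move: eq_ evx; rewrite /q !ipDr !ipNr ipZr ipxx e1 Uw.2 /t; lra.
Qed.

End property_E_inequality.

(** * Convex extensions and affine minorants *)

Lemma lipschitz_continuous {R : realType} {H : normedModType R} (f : H -> R)
    (L : R) :
  (forall a b, f a - f b <= L * `|a - b|) -> continuous f.
Proof.
move=> fL x; apply/cvgrPdist_le => eps eps0; near=> z.
have h : `|x - z| <= eps / (`|L| + 1).
  near: z; move/cvgrPdist_le : (@cvg_id _ (nbhs x)); apply.
  by rewrite divr_gt0// ltr_wpDl.
have {}h : L * `|x - z| <= eps.
  rewrite ler_pdivlMr ?ltr_wpDl// in h.
  apply: le_trans h; rewrite mulrC ler_wpM2l//.
  by rewrite (le_trans (ler_norm _))// lerDl.
rewrite ler_norml (le_trans (fL _ _) h) andbT lerNl opprB.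
by apply: le_trans h; rewrite distrC.
Unshelve. all: by end_near. Qed.

Section convex_functions.
Context {R : realType} {H : hilbertType R}.
Implicit Types G : H -> R.

Lemma convex_functionP G : convex_function [set: H] G <->
  forall t a b, 0 <= t <= 1 ->
    G (t *: a + (1 - t) *: b) <= t * G a + (1 - t) * G b.
Proof.
split=> [cG t a b /andP[t0 t1]|cG t a b _ _].
  exact: (cG (Itv01 t0 t1) a b (in_setT _) (in_setT _)).
by apply: cG; rewrite ge0 le1.
Qed.

Lemma lipschitz_bound G : lipschitz G ->
  exists2 L, 0 <= L & forall a b, G a - G b <= L * `|a - b|.
Proof.
move=> lG; have [L [L0 GL]] : exists L, 0 <= L /\ L.-lipschitz G.
  near (pinfty_nbhs R) => L; exists L; split; near: L => //.
  exact: nbhs_pinfty_ge.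
exists L => // a b; apply: (le_trans (ler_norm _)).
exact: (GL (a, b)).
Unshelve. all: by end_near. Qed.

Lemma lipschitzW G L : (forall a b, G a - G b <= L * `|a - b|) -> lipschitz G.
Proof.
move=> GL; apply: (@klipschitzW _ _ _ L).
  exact: (@globally_properfilter _ _ (0, 0)).
move=> [a b] _ /=.
by rewrite ler_norml GL andbT lerNl opprB distrC GL.
Qed.

End convex_functions.

Section convex_extension.
Context {R : realType} {Z : hilbertType R}.

(** The extension is the infimum of the right-hand side of the hypothesis over all finite convex
    combinations of points of [X]. The hypothesis keeps it from falling below [g] on [X]; the
    one-point combination gives the other inequality. *)
Lemma convex_lipschitz_extension (X : set Z) (g : Z -> R) (c : R) :
  0 <= c -> X !=set0 ->
  (forall n (xs : 'I_n -> Z) mu x, X x -> (forall i, X (xs i)) ->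
    convex_weights mu ->
    g x <= \sum_i mu i * g (xs i) + c * `|x - \sum_i mu i *: xs i|) ->
  exists p : Z -> R, [/\ convex_function [set: Z] p,
    forall a b, p a - p b <= c * `|a - b| & forall x, X x -> p x = g x].
Proof.
move=> c0 [x0 Xx0] gX.
pose S z := [set r | exists n (xs : 'I_n -> Z) mu,
  [/\ forall i, X (xs i), convex_weights mu &
      r = \sum_i mu i * g (xs i) + c * `|z - \sum_i mu i *: xs i|]].
have Sx z x : X x -> S z (g x + c * `|z - x|).
  move=> Xx; exists 1%N, (fun=> x), (fun=> 1); split=> //.
    by split=> //; rewrite big_ord1.
  by rewrite !big_ord1 mul1r scale1r.
have Slb z x : X x -> lbound (S z) (g x - c * `|z - x|).
  move=> Xx _ [n [xs [mu [Xxs wmu ->]]]].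
  rewrite lerBlDr (le_trans (gX _ _ _ _ Xx Xxs wmu))// -addrA lerD2l -mulrDr.
  by rewrite ler_wpM2l// (le_trans (ler_distD z _ _))// addrC (distrC x).
have Sinf z : has_inf (S z).
  by split; eexists; [exact: (Sx _ x0)|exact: (Slb _ x0)].
exists (fun z => inf (S z)); split.
- apply/convex_functionP => t a b /andP[t0 t1].
  have t1' : 0 <= 1 - t by rewrite subr_ge0.
  apply/ler_addgt0Pr => eps eps0.
  have [_ [n1 [x1 [m1 [Xx1 [m10 m11] ->]]]] r1] := inf_adherent eps0 (Sinf a).
  have [_ [n2 [x2 [m2 [Xx2 [m20 m21] ->]]]] r2] := inf_adherent eps0 (Sinf b).
  (* Two nearly optimal combinations are concatenated, their weights scaled by [t] and [1 - t]; this
     makes the infimum convex. *)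
  pose xs (i : 'I_(n1 + n2)) :=
    match fintype.split i with inl j => x1 j | inr j => x2 j end.
  pose mu (i : 'I_(n1 + n2)) :=
    match fintype.split i with inl j => t * m1 j | inr j => (1 - t) * m2 j end.
  have sumE (V : lmodType R) (F : Z -> V) : \sum_i mu i *: F (xs i) =
      t *: \sum_i m1 i *: F (x1 i) + (1 - t) *: \sum_i m2 i *: F (x2 i).
    rewrite big_split_ord /= !scaler_sumr; congr (_ + _); apply: eq_bigr => i _;
      rewrite /mu /xs ?(unsplitK (inl i)) ?(unsplitK (inr i)) ?scalerA//.
  have Sab : S (t *: a + (1 - t) *: b) (\sum_i mu i * g (xs i) +
      c * `|t *: a + (1 - t) *: b - \sum_i mu i *: xs i|).
    exists (n1 + n2)%N, xs, mu; split=> //.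
      by move=> i; rewrite /xs; case: fintype.split.
    split=> [i|].
      by rewrite /mu; case: fintype.split => j; rewrite mulr_ge0.
    have := sumE R^o (fun=> 1).
    rewrite (_ : \sum_i mu i *: _ = \sum_i mu i); last first.
      by apply: eq_bigr => i _; exact: mulr1.
    rewrite (_ : \sum_i m1 i *: _ = 1); last first.
      by rewrite -[RHS]m11; apply: eq_bigr => i _; exact: mulr1.
    rewrite (_ : \sum_i m2 i *: _ = 1); last first.
      by rewrite -[RHS]m21; apply: eq_bigr => i _; exact: mulr1.
    by move=> ->; rewrite /GRing.scale/= !mulr1 addrC subrK.
  apply: (le_trans (ge_inf (Sinf _).2 Sab)).
  rewrite (sumE Z id) (sumE R^o g : \sum_i mu i * g (xs i) = _).
  rewrite [X in `|X|](_ : _ = t *: (a - \sum_i m1 i *: x1 i) +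
     (1 - t) *: (b - \sum_i m2 i *: x2 i)); last first.
    by rewrite !scalerBr opprD addrACA.
  have := ler_normD (t *: (a - \sum_i m1 i *: x1 i))
    ((1 - t) *: (b - \sum_i m2 i *: x2 i)).
  rewrite !normrZ (ger0_norm t0) (ger0_norm t1').
  move/(ler_wpM2l c0)/(lerD (lexx (t * \sum_i m1 i * g (x1 i) +
    (1 - t) * \sum_i m2 i * g (x2 i)))) => le0.
  apply: (le_trans le0).
  have := ler_wpM2l t0 (ltW r1); have := ler_wpM2l t1' (ltW r2).
  by move=> le1 le2; lra.
- move=> a b; rewrite lerBlDr -lerBlDl.
  apply: lb_le_inf; first exact: (Sinf b).1.
  move=> _ [n [xs [mu [Xxs wmu ->]]]]; rewrite lerBlDl.
  have Sa : S a (\sum_i mu i * g (xs i) + c * `|a - \sum_i mu i *: xs i|).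
    by exists n, xs, mu.
  apply: (le_trans (ge_inf (Sinf a).2 Sa)).
  rewrite addrCA lerD2l -mulrDr ler_wpM2l//; exact: ler_distD.
- move=> x Xx; apply/eqP; rewrite eq_le; apply/andP; split.
    apply: (le_trans (ge_inf (Sinf x).2 (Sx x x Xx))).
    by rewrite subrr normr0 mulr0 addr0.
  apply: lb_le_inf; first exact: (Sinf x).1.
  by have := Slb x x Xx; rewrite subrr normr0 mulr0 subr0.
Qed.

End convex_extension.

(** * Proximal points and affine minorants *)

Section affine_minorants.
Context {R : realType} {H : hilbertType R}.

(** The bound on the slope makes the extensions of all minorants [L]-Lipschitz, so that their
    supremum is finite and [L]-Lipschitz. *)
Definition affine_minorant (f : H -> R) (L : R) (ae : R * H) :=
  `|ae.2| <= L /\ forall z, ae.1 + ip ae.2 z <= f z.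

(* By the parallelogram identity, minimising sequences are Cauchy. *)
Lemma proximal_point (f : H -> R) (L tau : R) (y : H) : 0 < tau ->
  convex_function [set: H] f -> (forall a b, f a - f b <= L * `|a - b|) ->
  exists p, forall z,
    f p + `|p - y| ^+ 2 / (2 * tau) <= f z + `|z - y| ^+ 2 / (2 * tau).
Proof.
move=> tau0 /convex_functionP cf fL.
pose k := (2 * tau)^-1.
have k0 : 0 < k by rewrite invr_gt0 mulr_gt0.
pose phi z := f z + `|z - y| ^+ 2 * k.
pose m := inf (range phi).
have phi_inf : has_inf (range phi).
  split; first by exists (phi 0); exists 0.
  (* The minimum over [r] of [f y - L * r + k * r ^+ 2], by completing the square. *)
  exists (f y - L ^+ 2 / (4 * k)) => _ [z _ <-].
  have := fL y z; rewrite distrC; set r := `|z - y| => fLz.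
  have : 0 <= (2 * k * r - L) ^+ 2 / (4 * k).
    by rewrite divr_ge0 ?sqr_ge0 ?mulr_ge0 ?ltW.
  have -> : (2 * k * r - L) ^+ 2 / (4 * k) =
      r ^+ 2 * k - L * r + L ^+ 2 / (4 * k).
    by field; rewrite gt_eqF.
  by rewrite /phi -/r; lra.
have m_le z : m <= phi z by apply: ge_inf; [exact: phi_inf.2|exists z].
(* The quadratic term makes [phi] strongly convex at midpoints, so near-minimisers are close to each
   other. *)
have phi_mid a b : m + `|a - b| ^+ 2 * k / 4 <= (phi a + phi b) / 2.
  have := m_le (2^-1 *: a + (1 - 2^-1) *: b).
  have := cf 2^-1 a b; rewrite invr_ge0 ler0n invf_le1 ?ler1n// => /(_ isT).
  have -> : 1 - 2^-1 = 2^-1 :> R by field.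
  rewrite /phi -scalerDr.
  have -> : `|2^-1 *: (a + b) - y| ^+ 2 =
      `|a - y| ^+ 2 / 2 + `|b - y| ^+ 2 / 2 - `|a - b| ^+ 2 / 4.
    rewrite -!ipxx !ipE (ipC b a) (ipC y a) (ipC y b); by field.
  set A := `|a - y| ^+ 2; set B := `|b - y| ^+ 2; set D := `|a - b| ^+ 2.
  by move=> h1 h2; lra.
have adh n : exists z, phi z <= m + n.+1%:R^-1.
  have [|_ [z _ <-] zm] := @inf_adherent _ _ n.+1%:R^-1 _ phi_inf.
    by rewrite invr_gt0.
  by exists z; exact: ltW.
have [zs zsP] := choice adh.
have /cvg_ex[p zsp] : cvg (zs @ \oo).
  apply/cauchy_cvgP/cauchy_ballP => eps eps0; near_simpl.
  have d0 : 0 < eps ^+ 2 * k / 4 by rewrite !divr_gt0 ?mulr_gt0 ?exprn_gt0.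
  near=> i j => /=; rewrite -ball_normE /=.
  have ni : i.+1%:R^-1 < eps ^+ 2 * k / 4.
    by near: i; exact: (near_infty_natSinv_lt (PosNum d0)).
  have nj : j.+1%:R^-1 < eps ^+ 2 * k / 4.
    by near: j; exact: (near_infty_natSinv_lt (PosNum d0)).
  have := phi_mid (zs i) (zs j); have := zsP i; have := zsP j.
  move=> hj hi mid; rewrite -(@ltr_pXn2r _ 2)// ?nnegrE ?(ltW eps0)//.
  rewrite -(ltr_pM2r k0).
  move: ni nj hj hi mid; set u := i.+1%:R^-1; set w := j.+1%:R^-1.
  by clearbody u w; lra.
exists p => z; rewrite -/k -/(phi p) -/(phi z).
apply: le_trans (m_le z).
have phi_cvg : phi (zs n) @[n --> \oo] --> phi p.
  have f_cvg : f (zs n) @[n --> \oo] --> f p.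
    exact: (cvg_comp _ _ zsp (lipschitz_continuous fL (x := p))).
  have c1 : `|zs n - y| @[n --> \oo] --> `|p - y|.
    by apply: cvg_norm; apply: cvgB => //; exact: cvg_cst.
  have c2 : `|zs n - y| ^+ 2 @[n --> \oo] --> `|p - y| ^+ 2.
    exact: (cvg_comp _ _ c1 (@exprn_continuous R 2 _)).
  exact: (cvgD f_cvg (cvgM c2 (cvg_cst k))).
apply/ler_addgt0Pr => eps eps0.
have e2 : 0 < eps / 2 by rewrite divr_gt0.
near \oo => n.
have h1 : `|phi p - phi (zs n)| <= eps / 2.
  by near: n; move/cvgrPdist_le : phi_cvg; exact.
have h2 : n.+1%:R^-1 < eps / 2.
  by near: n; exact: (near_infty_natSinv_lt (PosNum e2)).
have := zsP n; have := ler_norm (phi p - phi (zs n)); move: h1 h2.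
by set u := n.+1%:R^-1; clearbody u; lra.
Unshelve. all: by end_near.
Qed.

(** The vector [(y - p) / tau] is a subgradient of [f] at the proximal point [p]. For small [tau]
    the resulting minorant, exact at [p], is almost exact at [y]. *)
Lemma affine_minorant_approx (f : H -> R) (L eps : R) (y : H) :
  0 <= L -> 0 < eps ->
  convex_function [set: H] f -> (forall a b, f a - f b <= L * `|a - b|) ->
  exists2 ae, affine_minorant f L ae & f y - eps <= ae.1 + ip ae.2 y.
Proof.
move=> L0 eps0 cf fL.
(* The error at [y] is at most [L * |y - p| = L * tau * |e| <= tau * L ^+ 2 <= eps]. *)
pose tau := eps / (L ^+ 2 + 1).
have L1 : 0 < L ^+ 2 + 1 by rewrite ltr_wpDl ?sqr_ge0.
have tau0 : 0 < tau by rewrite divr_gt0.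
have [p pmin] := proximal_point y tau0 cf fL.
pose e := tau^-1 *: (y - p).
(* First-order condition for the proximal minimum along the segment from [p] to [z]. *)
have sub z : f p + ip e (z - p) <= f z.
  rewrite -subr_ge0.
  apply: (@quadratic_slope_ge0 _ _ (`|z - p| ^+ 2 / (2 * tau)) 1) => // s.
  move=> /andP[s0 s1].
  have := pmin (s *: z + (1 - s) *: p).
  have := (convex_functionP f).1 cf s z p.
  rewrite (ltW s0) s1 => /(_ isT).
  have -> : s *: z + (1 - s) *: p - y = (p - y) + s *: (z - p).
    rewrite scalerBl scale1r scalerBr addrCA -!addrA; congr (_ + _).
    by rewrite addrA [RHS]addrC.
  rewrite (sqr_normD (p - y)) ipZr normrZ exprMn (real_normK (num_real s)).
  have -> : ip e (z - p) = - (ip (p - y) (z - p) / tau).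
    by rewrite /e ipZl -opprB ipNl mulrN mulrC.
  set A := `|p - y| ^+ 2; set B := ip _ _; set D := `|z - p| ^+ 2.
  move=> h1 h2.
  have -> : s * (f z - (f p + - (B / tau))) + s ^+ 2 * (D / (2 * tau)) =
    (s * f z + (1 - s) * f p) + (A + 2 * (s * B) + s ^+ 2 * D) / (2 * tau) -
    (f p + A / (2 * tau)) by field; rewrite gt_eqF.
  by rewrite subr_ge0 (le_trans h2)// lerD2r.
(* Testing the subgradient inequality at [p + e] gives [|e|^2 <= L * |e|]. *)
have eL : `|e| <= L.
  have [->|e0] := eqVneq e 0; first by rewrite normr0.
  have := fL (p + e) p; have := sub (p + e).
  rewrite (_ : p + e - p = e) ?ipxx ?expr2 => [h1 h2|].
    by rewrite -(@ler_pM2r _ `|e|) ?normr_gt0//; lra.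
  by rewrite addrAC subrr add0r.
exists (f p - ip e p, e).
  split=> //= z; have := sub z; rewrite ipDr ipNr; lra.
have yp : y - p = tau *: e by rewrite scalerA divff ?scale1r// gt_eqF.
have -> : ip e y = ip e p + tau * `|e| ^+ 2.
  by rewrite -ipxx -ipZr -yp -ipDr addrCA subrr addr0.
have := fL y p; rewrite yp normrZ (gtr0_norm tau0) => h.
have h1 : L * (tau * `|e|) <= L * (tau * L) by rewrite !ler_wpM2l ?(ltW tau0).
have h2 : eps = tau * (L ^+ 2 + 1) by rewrite /tau mulfVK ?gt_eqF.
have h3 : 0 <= tau * `|e| ^+ 2 by rewrite mulr_ge0 ?sqr_ge0 ?ltW.
move=> /=; nra.
Qed.

End affine_minorants.

(** * Pulling a convex function back along [v] *)

Section convex_pullback.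
Context {R : realType} {Z Y : hilbertType R}.
Variables (X : set Z) (v : Z -> Y) (P : set Z).
Hypotheses (Ev : property_E X v) (sP : submodule P).
Hypothesis XP : forall a b, X a -> X b -> P (a - b).
Hypotheses (rP : room (Y := Y) P) (X0 : X !=set0).

Lemma functional_extension (e : Y) :
  exists p : Z -> R, [/\ convex_function [set: Z] p,
    forall a b, p a - p b <= `|e| * `|a - b| &
    forall x, X x -> p x = ip e (v x)].
Proof.
apply: convex_lipschitz_extension => // n xs mu x Xx Xxs wmu.
have [->|e0] := eqVneq e 0.
  rewrite ip0l normr0 mul0r addr0 big1// => i _; by rewrite ip0l mulr0.
have ne : 0 < `|e| by rewrite normr_gt0.
have u1 : `| `|e|^-1 *: e| = 1 by rewrite normrZ normfV normr_id mulVf// gt_eqF.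
have := property_E_weights Ev sP XP rP Xx Xxs wmu u1.
rewrite ipZl; under eq_bigr do rewrite ipZl mulrCA.
rewrite -mulr_sumr -(ler_pM2l ne) mulrDr !mulrA mulfV ?gt_eqF// !mul1r.
by [].
Qed.

(** The last clause bounds local slopes quantitatively: a one-sided bound on [f] over a ball about
    [v x] gives a two-sided bound on [G] over the ball of the same radius about [x]. *)
Lemma convex_pullback (f : Y -> R) (L : R) : 0 <= L ->
  convex_function [set: Y] f -> (forall a b, f a - f b <= L * `|a - b|) ->
  exists G : Z -> R, [/\ convex_function [set: Z] G,
    forall a b, G a - G b <= L * `|a - b|,
    forall x, X x -> G x = f (v x) &
    forall x r delta, X x -> 0 <= r -> 0 < delta ->
      (forall y, `|y - v x| <= delta -> f y - f (v x) <= r * `|y - v x|) ->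
      forall z, `|z - x| <= delta -> `|G z - G x| <= r * `|z - x|].
Proof.
move=> L0 cf fL; have [p pP] := choice functional_extension.
pose S z := [set r | exists2 ae, affine_minorant f L ae &
                                 r = ae.1 + p ae.2 z].
have p_le e z x : X x -> p e z <= ip e (v x) + `|e| * `|z - x|.
  move=> Xx; have [_ pL pX] := pP e.
  by rewrite -lerBlDl -(pX _ Xx).
have S_le z x r : X x -> S z r -> r <= f (v x) + L * `|z - x|.
  move=> Xx [[a e] [/= eL fae] ->] /=.
  rewrite (le_trans (lerD (lexx a) (p_le e z x Xx)))// addrA lerD//.
  by rewrite ler_wpM2r.
have Ssup z : has_sup (S z).
  have [x0 Xx0] := X0; split; last first.
    by exists (f (v x0) + L * `|z - x0|) => r; exact: S_le.
  have [ae aef _] := affine_minorant_approx (v x0) L0 ltr01 cf fL.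
  by exists (ae.1 + p ae.2 z); exists ae.
pose G z := sup (S z).
have G_ge z ae : affine_minorant f L ae -> ae.1 + p ae.2 z <= G z.
  by move=> aef; apply: ub_le_sup; [exact: (Ssup z).2|exists ae].
have G_le z u : (forall ae, affine_minorant f L ae -> ae.1 + p ae.2 z <= u) ->
    G z <= u.
  move=> H; apply: ge_sup; first exact: (Ssup z).1.
  by move=> _ [ae aef ->]; exact: H.
have GX x : X x -> G x = f (v x).
  move=> Xx; apply/eqP; rewrite eq_le; apply/andP; split.
    apply: G_le => -[a e] [_ /= fae]; have [_ _ ->//] := pP e.
  apply/ler_addgt0Pr => eps eps0; rewrite -lerBlDr.
  have [ae aef le1] := affine_minorant_approx (v x) L0 eps0 cf fL.
  apply: (le_trans le1); apply: le_trans (G_ge x _ aef).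
  by have [_ _ ->] := pP ae.2.
have cG : convex_function [set: Z] G.
  apply/convex_functionP => t a b t01.
  apply: G_le => ae aef; have [/convex_functionP cp _ _] := pP ae.2.
  have /andP[t0 t1] := t01.
  have h1 := ler_wpM2l t0 (G_ge a _ aef).
  have t1' : 0 <= 1 - t by rewrite subr_ge0.
  have h2 := ler_wpM2l t1' (G_ge b _ aef).
  by have h3 := cp t a b t01; lra.
exists G; split => //.
  move=> a b; rewrite lerBlDl; apply: G_le => ae aef.
  have [_ pL _] := pP ae.2.
  have h1 : p ae.2 a - p ae.2 b <= L * `|a - b|.
    by rewrite (le_trans (pL a b))// ler_wpM2r//; exact: aef.1.
  by have h2 := G_ge b _ aef; lra.
move=> x r delta Xx r0 delta0 fr.
have up z : `|z - x| <= delta -> G z - G x <= r * `|z - x|.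
  move=> zx; rewrite lerBlDl (GX _ Xx); apply: G_le => -[a e] [/= eL fae].
  have [er|er] := leP `|e| r.
    rewrite (le_trans (lerD (lexx a) (p_le e z x Xx)))// addrA lerD//.
    by rewrite ler_wpM2r.
  have ne : 0 < `|e| by rewrite (le_lt_trans r0).
  (* a minorant steeper than [r] lies below [f] at the point at distance
     [delta] from [v x] in the direction [e] *)
  pose y := v x + (delta / `|e|) *: e.
  have yd : `|y - v x| = delta.
    rewrite /y addrAC subrr add0r normrZ ger0_norm ?divr_ge0 ?(ltW delta0)//.
    by rewrite mulfVK// gt_eqF.
  have := fr y; rewrite yd lexx => /(_ isT) h1.
  have := fae y; rewrite /y ipDr ipZr ipxx -/y => h2.
  have h3 := p_le e z x Xx.
  have h4 : delta / `|e| * `|e| ^+ 2 = delta * `|e|.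
    by rewrite expr2 mulrA mulfVK// gt_eqF.
  (* The bound at distance [delta] descends to the smaller distance [|z - x|] because the slope
     [|e|] exceeds [r]. *)
  have h5 : 0 <= (`|e| - r) * (delta - `|z - x|).
    by rewrite mulr_ge0 ?subr_ge0// ltW.
  by rewrite h4 in h2; lra.
move=> z zx; rewrite ler_norml up// andbT.
(* convexity bounds [G x - G z] by the increment of [G] at the reflection of
   [z] in [x] *)
pose z' := x - (z - x).
have z'x : `|z' - x| = `|z - x| by rewrite /z' addrAC subrr add0r normrN.
have := up z'; rewrite z'x => /(_ zx) h1.
have half01 : 0 <= (2^-1 : R) <= 1 by rewrite invr_ge0 ler0n invf_le1 ?ler1n.
have := (convex_functionP G).1 cG 2^-1 z z' half01.
have half : 1 - 2^-1 = 2^-1 :> R by field.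
have -> : 2^-1 *: z + (1 - 2^-1) *: z' = x.
  rewrite half -scalerDr /z' addrCA subKr -[x + x]mulr2n.
  by rewrite -[x *+ 2]scaler_nat scalerA mulVf ?pnatr_eq0// scale1r.
rewrite half => h2.
by lra.
Qed.

End convex_pullback.

(** * The local Lipschitz constant and integration *)

Section local_lipschitz_constant.
Context {R : realType} {H : normedModType R}.
Implicit Types (f : H -> R) (y z : H).

(* The term [z = y] contributes [0 / 0 = 0] to the supremum. *)
Definition ball_slope f n y : \bar R :=
  ereal_sup [set (`|f z - f y| / `|z - y|)%:E | z in ball y n.+1%:R^-1].

Lemma ball_slope_ge0 f n y : (0 <= ball_slope f n y)%E.
Proof.
apply: ereal_sup_ubound; exists y; first by apply: ballxx; rewrite invr_gt0.
by rewrite !subrr normr0 mul0r.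
Qed.

Lemma ball_slope_ub f n y z : ball y n.+1%:R^-1 z ->
  ((`|f z - f y| / `|z - y|)%:E <= ball_slope f n y)%E.
Proof. by move=> yz; apply: ereal_sup_ubound; exists z. Qed.

Lemma nbhs_ball_nat y (V : set H) : nbhs y V ->
  exists n, ball y n.+1%:R^-1 `<=` V.
Proof.
move=> /nbhs_ballP[e e0 eV].
have [n ne] : exists n, n.+1%:R^-1 < e :> R.
  exact: (filter_ex (near_infty_natSinv_lt (PosNum e0))).
by exists n => z; rewrite -ball_normE /= => yz; apply: eV;
  rewrite -ball_normE /= (lt_trans yz).
Qed.

(** A countable infimum over full balls replaces the punctured limit and absorbs the isolated case,
    where every slope is 0. This form yields measurability. *)
Lemma lipE f y : lip f y = ereal_inf (range (ball_slope f ^~ y)).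
Proof.
rewrite /lip; case: asboolP => [[_ [V yV VE]]|niso]; apply/eqP;
  rewrite eq_le; apply/andP; split.
- by apply: le_ereal_inf_tmp => _ [n _ <-]; exact: ball_slope_ge0.
- have [n nV] := nbhs_ball_nat yV.
  apply: ge_ereal_inf; exists (ball_slope f n y); first by exists n.
  apply: ge_ereal_sup => _ [z /nV Vz <-].
  have -> : z = y by move/seteqP : VE => [/(_ z) + _]; apply.
  by rewrite !subrr normr0 mul0r.
- apply: le_ereal_inf_tmp => _ [n _ <-]; rewrite limf_esupE.
  apply: ge_ereal_inf.
  exists (ereal_sup [set (`|f z - f y| / `|z - y|)%:E |
    z in [set z | z != y] `&` ball y n.+1%:R^-1]).
    exists ([set z | z != y] `&` ball y n.+1%:R^-1) => //.
    have : nbhs y (ball y n.+1%:R^-1) by apply: nbhsx_ballx; rewrite invr_gt0.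
    by apply: filterS => z yz zy.
  apply: ge_ereal_sup => _ [z [_ yz] <-]; exact: ball_slope_ub.
- rewrite limf_esupE; apply: le_ereal_inf_tmp => _ [V yV <-].
  have [n nV] := nbhs_ball_nat yV.
  apply: ge_ereal_inf; exists (ball_slope f n y); first by exists n.
  (* A point other than [y] is needed so that the supremum over the punctured set dominates the
     value 0 contributed by [z = y]. *)
  have [w [/= wy Vw]] : exists w, w != y /\ V w.
    apply: contrapT => /forallNP nw; apply: niso; split; first by rewrite inE.
    exists (ball y n.+1%:R^-1); first by apply: nbhsx_ballx; rewrite invr_gt0.
    rewrite setIT; apply/seteqP; split=> z; last first.
      by move=> ->; apply: ballxx; rewrite invr_gt0.
    move=> yz; apply: contrapT => /eqP zy; apply: (nw z); split=> //.
    exact: nV.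
  apply: ge_ereal_sup => _ [z yz <-].
  have [->|zy] := eqVneq z y.
    rewrite !subrr normr0 mul0r; apply: le_ereal_sup_tmp.
    exists (`|f w - f y| / `|w - y|)%:E; first by exists w.
    by rewrite lee_fin divr_ge0.
  by apply: ereal_sup_ubound; exists z => //; exact: nV.
Qed.

Lemma lip_ge0 f y : (0 <= lip f y)%E.
Proof.
by rewrite lipE; apply: le_ereal_inf_tmp => _ [n _ <-]; exact: ball_slope_ge0.
Qed.

Lemma lip_le f y r delta : 0 <= r -> 0 < delta ->
  (forall z, `|z - y| <= delta -> `|f z - f y| <= r * `|z - y|) ->
  (lip f y <= r%:E)%E.
Proof.
move=> r0 delta0 fr; rewrite lipE.
have [n nd] := nbhs_ball_nat (nbhsx_ballx y _ delta0).
apply: ge_ereal_inf; exists (ball_slope f n y); first by exists n.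
apply: ge_ereal_sup => _ [z /nd + <-].
rewrite -ball_normE /= distrC => /ltW yz; rewrite lee_fin.
have [->|zy] := eqVneq z y; first by rewrite !subrr normr0 mul0r.
by rewrite ler_pdivrMr ?normr_gt0 ?subr_eq0//; exact: fr.
Qed.

Lemma lip_lt f y r : (lip f y < r%:E)%E -> exists2 delta, 0 < delta &
  forall z, `|z - y| <= delta -> `|f z - f y| <= r * `|z - y|.
Proof.
rewrite lipE => /ereal_inf_lt[_ [n _ <-] nr].
(* Halving the radius puts the closed ball inside the open one. *)
exists (n.+1%:R^-1 / 2); first by rewrite !divr_gt0 ?invr_gt0.
move=> z zy; have [->|neq] := eqVneq z y.
  by rewrite !subrr !normr0 mulr0.
rewrite -ler_pdivrMr ?normr_gt0 ?subr_eq0// -lee_fin.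
apply: le_trans (ltW nr); apply: ball_slope_ub.
rewrite -ball_normE /= distrC (le_lt_trans zy)//.
by rewrite ltr_pdivrMr// mulr2n mulrDr mulr1 ltrDl invr_gt0.
Qed.

(** A point [z] whose slope from [y] exceeds [b] still serves for nearby centres: the quotient is
    continuous in the centre away from [z], and the ball is open. For [b >= 0] such a [z] differs
    from [y]; negative [b] is treated apart. *)
Lemma lower_semicontinuous_ball_slope f n : continuous f ->
  lower_semicontinuous (ball_slope f n).
Proof.
move=> cf y b; have [b0 _|b0] := ltP b 0.
  exists setT => [|y' _]; first exact: filterT.
  by rewrite (lt_le_trans _ (ball_slope_ge0 f n y')) // lte_fin.
move=> /ereal_sup_gt[_ [z yz <-]]; rewrite lte_fin => bz.
have zy : `|z - y| != 0.
  by apply: contraTneq bz => ->; rewrite invr0 mulr0 -leNgt.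
have cq : `|f z - f y'| / `|z - y'| @[y' --> y] --> `|f z - f y| / `|z - y|.
  apply: cvgM; last apply: cvgV => //; apply: cvg_norm; apply: cvgB;
    by [exact: cvg_cst|exact: cf|exact: cvg_id].
exists ([set y' | b < `|f z - f y'| / `|z - y'|] `&` ball z n.+1%:R^-1).
  apply: filterI; first exact: (cvgr_gt _ cq).
  have [e e0 eb] : exists2 e, 0 < e & ball y e `<=` ball z n.+1%:R^-1.
    apply/nbhs_ballP; apply: open_nbhs_nbhs; split; first exact: ball_open.
    exact: ball_sym.
  by apply/nbhs_ballP; exists e.
move=> y' [/= by' /ball_sym zy'].
by rewrite (lt_le_trans _ (ball_slope_ub f zy')).
Qed.

Lemma measurable_lip f : continuous f ->
  measurable_fun [set: borel H] (lip f : borel H -> \bar R).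
Proof.
move=> cf.
have -> : lip f = (fun y => einfs (ball_slope f ^~ y) 0%N).
  apply/funext => y; rewrite lipE /einfs /=; congr ereal_inf.
  apply/seteqP; split=> [_ [n _ <-]|_ [n _ <-]]; exists n => //.
apply: measurable_fun_einfs => n.
apply: (measurability _ (ErealGenOInfty.measurableE R)).
move=> /= _ [_ [a ->]] <-; apply: measurableI => //.
apply: sub_sigma_algebra; rewrite preimage_itvoy.
exact: ((lower_semicontinuousP _).1
  (@lower_semicontinuous_ball_slope f n cf) a).
Qed.

End local_lipschitz_constant.

(** * Transfer of integrals and variances *)

Section integration.
Local Open Scope ereal_scope.

Lemma measurable_of_continuous {R : realType} {H : normedModType R}
    (f : H -> R) :
  continuous f -> measurable_fun [set: borel H] (f : borel H -> R).
Proof.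
move=> cf; apply: (measurability _ (RGenOpens.measurableE R)).
move=> _ [_ [a [b ->]] <-]; apply: measurableI => //.
apply: sub_sigma_algebra; move/continuousP : cf; apply.
exact: interval_open.
Qed.

Lemma probability_setI1 {d} {T : measurableType d} {R : realType}
    (mu : probability T R) (X A : set T) : measurable X -> measurable A ->
  mu X = 1 -> mu A = mu (X `&` A).
Proof.
move=> mX mA muX; rewrite (measureDI mu mA mX) setIC -[RHS]add0e.
congr (_ + _); apply/eqP; rewrite eq_le measure_ge0 andbT.
have <- : mu (~` X) = 0 by rewrite probability_setC// muX subee.
rewrite setDE; apply: le_measure; rewrite ?inE.
- by apply: measurableI => //; exact: measurableC.
- exact: measurableC.
- exact: subIsetr.
Qed.

Lemma nonempty_of_mu1 {d} {T : measurableType d} {R : realType}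
    (mu : probability T R) (X : set T) : mu X = 1 -> X !=set0.
Proof.
move=> muX; apply/set0P/eqP => X0.
by move: muX; rewrite X0 measure0 => /esym/eqP; rewrite onee_eq0.
Qed.

Lemma ae_of_mu1 {d} {T : measurableType d} {R : realType}
    (mu : probability T R) (X : set T) (P : T -> Prop) :
  measurable X -> mu X = 1 -> X `<=` P -> \forall x \ae mu, P x.
Proof.
move=> mX muX XP; exists (~` X); split; first exact: measurableC.
  by rewrite probability_setC// muX subee.
by apply: subsetC => x /XP.
Qed.

(** Since [f] is measurable only on [X], it is replaced by [w], constant off [X]. Splitting [phi]
    into positive and negative parts gives the formula without integrability. *)
Lemma pushforward_onE {d d'} {T : measurableType d} {T' : measurableType d'}
    {R : realType} (mu : probability T R) (X : set T) (f : T -> T')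
    (mX : measurable X) (muX : mu X = 1) (mf : measurable_fun X f) :
  exists w : T -> T', [/\ measurable_fun [set: T] w,
    {in X, forall x, w x = f x} &
    forall phi : T' -> \bar R, measurable_fun [set: T'] phi ->
      \int[pushforward_on mX muX mf]_y phi y = \int[mu]_x phi (w x)].
Proof.
have [x0 Xx0] := nonempty_of_mu1 muX.
pose w x := if x \in X then f x else f x0.
have wX : {in X, forall x, w x = f x} by move=> x xX; rewrite /w xX.
have mw : measurable_fun [set: T] w.
  rewrite -(setUv X); apply/measurable_funU => //; first exact: measurableC.
  split; first by apply: (eq_measurable_fun f) => // x /wX.
  apply: (eq_measurable_fun (cst (f x0))) => //.
  by move=> x; rewrite inE => /= xX; rewrite /w memNset.
exists w; split=> // phi mphi.
pose w' : {mfun T >-> T'} := HB.pack w (isMeasurableFun.Build _ _ _ _ w mw).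
have ge0E psi : measurable_fun [set: T'] psi -> (forall y, 0 <= psi y) ->
    \int[pushforward_on mX muX mf]_y psi y = \int[mu]_x psi (w x).
  move=> mpsi psi0.
  rewrite (eq_measure_integral (pushforward mu w')); last first.
    move=> A mA _; rewrite /= /pushforward /pushforward_on.
    have mwA : measurable (w @^-1` A).
      by rewrite -[_ @^-1` _]setTI; exact: (mw measurableT).
    rewrite (probability_setI1 mX mwA muX); congr (mu _).
    by apply/seteqP; split=> x [Xx]; rewrite /= wX ?inE.
  by rewrite ge0_integral_pushforward// preimage_setT.
rewrite [LHS]integralE [RHS]integralE.
under [X in _ = X - _]eq_integral do rewrite (funepos_comp phi w)/=.
under [X in _ = _ - X]eq_integral do rewrite (funeneg_comp phi w)/=.
by rewrite (ge0E _ (measurable_funepos mphi) (funepos_ge0 phi))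
  (ge0E _ (measurable_funeneg mphi) (funeneg_ge0 phi)).
Qed.

Lemma variance_transfer {d d'} {T : measurableType d} {T' : measurableType d'}
    {R : realType} (mu : probability T R) (nu : probability T' R)
    (X : set T) (w : T -> T') (f : T' -> R) (g : T -> R) :
  measurable X -> mu X = 1 -> measurable_fun [set: T] w ->
  (forall phi : T' -> \bar R, measurable_fun [set: T'] phi ->
    \int[nu]_y phi y = \int[mu]_x phi (w x)) ->
  measurable_fun [set: T'] f -> measurable_fun [set: T] g ->
  (forall x, X x -> g x = f (w x)) -> 'V_nu[f] = 'V_mu[g].
Proof.
move=> mX muX mw nuE mf mg gf.
(* Used with the identity for the means and with the squared deviation from the common mean for the
   variances. *)
have E (h : R -> R) : measurable_fun setT h ->
    \int[nu]_y (h (f y))%:E = \int[mu]_x (h (g x))%:E.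
  move=> mh.
  have mhf : measurable_fun setT (fun y => (h (f y))%:E).
    by apply/measurable_EFinP; exact: measurableT_comp.
  rewrite nuE//; apply: ae_eq_integral => //.
  - exact: measurableT_comp mhf mw.
  - by apply/measurable_EFinP; exact: measurableT_comp.
  - by apply: (ae_of_mu1 mX muX) => x Xx _; rewrite gf.
have mean : 'E_nu[f] = 'E_mu[g].
  by rewrite expectation.unlock; exact: (E id).
rewrite /variance covariance.unlock mean; set c := fine _.
rewrite expectation.unlock; apply: (E (fun t => (t - c) * (t - c))%R).
by apply: measurable_funM; apply: measurable_funB.
Qed.

End integration.

(** Any slope strictly above a finite [lip f y] bounds the increments of [f] on some ball, hence
    those of [G] by hypothesis. *)
Lemma lip_pullback_le {R : realType} {Z Y : normedModType R} (f : Y -> R)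
    (G : Z -> R) (x : Z) (y : Y) :
  (forall r delta, 0 <= r -> 0 < delta ->
    (forall y', `|y' - y| <= delta -> f y' - f y <= r * `|y' - y|) ->
    forall z, `|z - x| <= delta -> `|G z - G x| <= r * `|z - x|) ->
  (lip G x <= lip f y)%E.
Proof.
move=> fG; have := lip_ge0 f y; case lE : (lip f y) => [l| |]//; last first.
  by move=> _; rewrite leey.
rewrite lee_fin => l0; apply/lee_addgt0Pr => e e0; rewrite -EFinD.
have [|delta delta0 fl] := @lip_lt _ _ f y (l + e).
  by rewrite lE lte_fin ltrDl.
have le0 : 0 <= l + e by rewrite addr_ge0// ltW.
apply: (lip_le le0 delta0); apply: fG => // y' /fl.
exact: le_trans (ler_norm _).
Qed.

Theorem corollary6p4 (R : realType) (Z Y : hilbertType R)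
    (X : set (borel Z)) (v : Z -> Y) (mX : measurable X)
    (Ev : property_E X v)
    (dimXY : infinite_dimensional Y \/
      exists m n, [/\ has_affine_dim (affine_hull X) m,
                      has_dim [set: Y] n & (m + 1 <= n)%N])
    (C : R) (C_ge0 : 0 <= C)
    (mu : probability (borel Z) R) (mu2 : finite_second_moment mu)
    (muX : mu X = 1%E)
    (varZ : forall G : Z -> R,
      convex_function [set: Z] G -> lipschitz G ->
      ('V_mu[G] <= C%:E * \int[mu]_z (lip G z ^+ 2))%E) :
  let nu : probability (borel Y) R :=
    pushforward_on mX muX (property_E_measurable Ev) in
  forall f : Y -> R,
    convex_function [set: Y] f -> lipschitz f ->
    ('V_nu[f] <= C%:E * \int[nu]_y (lip f y ^+ 2))%E.
Proof.
move=> nu f cvxf lipf.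
have X0 := nonempty_of_mu1 muX.
have [P [sP XP rP]] := dim_room dimXY.
have [L L0 fL] := lipschitz_bound lipf.
have [G [cvxG GL GX Glip]] := convex_pullback Ev sP XP rP X0 L0 cvxf fL.
have lipG := lipschitzW GL.
have cf := lipschitz_continuous fL.
have cG := lipschitz_continuous GL.
have [w [mw wv nuE]] := pushforward_onE mX muX (property_E_measurable Ev).
have -> : 'V_nu[f] = 'V_mu[G].
  apply: (variance_transfer mX muX mw nuE).
  - exact: measurable_of_continuous.
  - exact: measurable_of_continuous.
  - by move=> x Xx; rewrite GX// wv// inE.
apply: (le_trans (varZ G cvxG lipG)).
rewrite lee_wpmul2l ?lee_fin//.
have mlip2 (H : hilbertType R) (g : H -> R) : continuous g ->
    measurable_fun [set: borel H] (fun z : borel H => (lip g z ^+ 2)%E).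
  move=> cg; under eq_fun do rewrite expe2.
  by apply: emeasurable_funM; exact: measurable_lip.
rewrite nuE; last exact: mlip2.
apply: ae_ge0_le_integral => //.
- by move=> z _; rewrite expe_ge0// lip_ge0.
- exact: mlip2.
- by move=> z _; rewrite expe_ge0// lip_ge0.
- by apply: (measurableT_comp (mlip2 _ _ cf)).
(* The comparison of local constants is available only on [X], which has full measure. *)
apply: (ae_of_mu1 mX muX) => z Xz _.
rewrite (wv z (mem_set Xz)) !expe2 lee_pmul ?lip_ge0//;
  apply: lip_pullback_le => r delta r0 d0; exact: Glip.
Qed.
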